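(* Let $\mathcal{A}=\langle\Sigma,Q,q_0,\delta,\pi\rangle$ be a game automaton such that for every $q\in Q$, $a\in\Sigma$ with $\delta(q,a)=(L,q_L)\vee(R,q_R)$ or $\delta(q,a)=(L,q_L)\wedge(R,q_R)$ we have $q_L\neq q_R$, let $L\subseteq\mathcal{T}_\Sigma$ be the language recognized by $\mathcal{A}$, and let $\mathcal{M}$ be the MBP corresponding to $\mathcal{A}$. Then $\mu(L)=val(\mathcal{M},s_{q_0})$.
   Context: Trees: $V=\{L,R\}^*$ (root $\epsilon$); a $\Sigma$-tree is $t:V\to\Sigma$; $\mathcal{T}_\Sigma=\Sigma^V$; $\mu$ is the coin-flipping (uniform product) probability measure on $\mathcal{T}_\Sigma$, with $\mu(\{t:t(v_1)=a_1,\dots,t(v_k)=a_k\})=|\Sigma|^{-k}$ for distinct $v_j$. A game automaton $\langle\Sigma,Q,q_0,\delta,\pi\rangle$ has finite state set $Q$, initial state $q_0$, priorities $\pi:Q\to\omega$, and transitions $\delta(q,a)$ each of the form $(L,q_L)\vee(R,q_R)$ or $(L,q_L)\wedge(R,q_R)$. A tree $t$ is accepted iff player $\exists$ wins the game starting at $\langle\epsilon,q_0\rangle$ where: from $\langle x,q\rangle$ with $\delta(q,t(x))=(L,q_L)\vee(R,q_R)$ player $\exists$ moves to $\langle xL,q_L\rangle$ or $\langle xR,q_R\rangle$, and with $\delta(q,t(x))=(L,q_L)\wedge(R,q_R)$ player $\forall$ chooses one of them; an infinite play is won by $\exists$ iff the largest priority of states visited infinitely often is even. A Markov branching play (MBP)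 is $\langle(S,E),(S_P,B_\exists,B_\forall),p,Par\rangle$: a finite directed graph $(S,E)$ with every vertex having a successor, a partition of $S$ into probabilistic, $\exists$-branching and $\forall$-branching states, a probability distribution $p(s)$ on the successors of each $s\in S_P$, and priorities $Par:S\to\omega$. From $s_0$, it generates a random state-labeled tree: root labeled $s_0$; each leaf is extended independently: a leaf labeled $s\in S_P$ gets one child labeled by a successor chosen according to $p(s)$; a leaf labeled by a branching state gets one child for each of its successors, labeled by that successor. This defines a probability measure $\mu_{\mathcal{M}}$ on the branching plays from $s_0$. Each branching play $T$ is a parity game on $T$ in which $\exists$ (resp. $\forall$) chooses a child at vertices labeled by $B_\exists$ (resp. $B_\forall$) states, and $\exists$ wins an infinite path iff the maximal priority of labels occurring infinitely often is even. $val(\mathcal{M},s_0)$ is the $\mu_{\mathcal{M}}$-probability of the set of branching plays from $s_0$ on which $\exists$ has a winning strategy. The MBP corresponding to $\mathcal{A}$: states are a probabilistic state $s_q$ for each $q\in Q$, and for each $(q,a)\in Q\times\Sigma$ a state $s_{q,a}$ which is $\exists$-branching if $\delta(q,a)=(L,q_L)\vee(R,q_R)$ and $\forall$-branching if $\delta(q,a)=(L,q_L)\wedge(R,q_R)$. The successors of $s_q$ are $\{s_{q,a}:a\in\Sigma\}$ with $p(s_q)(s_{q,a})=1/|\Sigma|$; the successors of $s_{q,a}$ are $s_{q_L}$ and $s_{q_R}$; priorities are $Par(s_q)=Par(s_{q,a})=\pi(q)$. *)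

(* Defs.v *)
From HB Require Import structures.
From mathcomp Require Import all_boot all_order all_algebra.
From mathcomp Require Import all_classical all_reals all_analysis.

Set Implicit Arguments.
Unset Strict Implicit.
Unset Printing Implicit Defensive.

Import Order.TTheory GRing.Theory Num.Theory.
Local Open Scope classical_set_scope.
Local Open Scope ring_scope.

Inductive dir := DL | DR.

Definition bool_of_dir (d : dir) : bool := if d is DR then true else false.
Definition dir_of_bool (b : bool) : dir := if b then DR else DL.
Lemma bool_of_dirK : cancel bool_of_dir dir_of_bool. Proof. by case. Qed.
HB.instance Definition _ := Finite.copy dir (can_type bool_of_dirK).

(* A vertex x of V is a word over {L,R}; the children of x are rcons x DL
   and rcons x DR; the root is [::]. *)
Definition vertex := seq dir.

Definition path_vertex (d : nat -> dir) (n : nat) : vertex := mkseq d n.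

Definition parity_win (c : nat -> nat) : Prop :=
  exists m : nat, [/\ ~~ odd m,
    (forall N, exists2 n, (N <= n)%N & c n = m) &
    (exists N, forall n, (N <= n)%N -> (c n <= m)%N)].

Inductive trans (Q : Type) := TOr of Q & Q | TAnd of Q & Q.

Definition trans_next (Q : Type) (t : trans Q) (d : dir) : Q :=
  match t with TOr qL qR | TAnd qL qR => if d is DL then qL else qR end.

Definition trans_is_or (Q : Type) (t : trans Q) : bool :=
  if t is TOr _ _ then true else false.

Definition trans_distinct (Q : Type) (t : trans Q) : Prop :=
  match t with TOr qL qR | TAnd qL qR => qL <> qR end.

Record game_automaton (Sigma Q : finType) := GameAutomaton {
  ga_q0 : Q;
  ga_delta : Q -> Sigma -> trans Q;
  ga_pri : Q -> nat }.

Section GameAutomatonSemantics.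
Variables (Sigma Q : finType) (A : game_automaton Sigma Q).

(* The game on t from <eps, q0> is played along a single branch, and the
   state component of the position at vertex x is determined by x:
   ga_run t pre q x = state reached at vertex pre ++ x when at vertex pre
   the state is q. *)
Fixpoint ga_run (t : vertex -> Sigma) (pre : vertex) (q : Q) (x : vertex) : Q :=
  match x with
  | [::] => q
  | d :: x' => ga_run t (rcons pre d) (trans_next (ga_delta A q (t pre)) d) x'
  end.

Definition ga_state (t : vertex -> Sigma) (x : vertex) : Q :=
  ga_run t [::] (ga_q0 A) x.

(* t is accepted iff player Exists has a winning strategy in the acceptance
   game from <eps, q0>.  Since each position <x,q> reachable from the
   initial position is determined by its vertex x (and so is the history
   leading to it), a strategy of Exists is a map sigma : vertex -> dir,
   used at the vertices whose transition is a disjunction. *)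
Definition ga_accepts (t : vertex -> Sigma) : Prop :=
  exists sigma : vertex -> dir,
    forall d : nat -> dir,
      (forall n, let x := path_vertex d n in
         trans_is_or (ga_delta A (ga_state t x) (t x)) -> d n = sigma x) ->
      parity_win (fun n => ga_pri A (ga_state t (path_vertex d n))).

End GameAutomatonSemantics.

(* The space T_Sigma of Sigma-trees with the sigma-algebra generated by the *)
(* cylinders {t | t v = a}; the coin-flipping measure is characterised by   *)
(* its values on finite cylinders.  (a0 only witnesses that Sigma is        *)
(* nonempty, as needed for a pointed carrier.)                              *)

Section TreeSpace.
Variables (Sigma : finType) (a0 : Sigma).

Definition tree_carrier (_ : Sigma) := vertex -> Sigma.
HB.instance Definition _ := Choice.on (tree_carrier a0).
HB.instance Definition _ := isPointed.Build (tree_carrier a0) (fun _ => a0).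

Definition coin_gen : set (set (tree_carrier a0)) :=
  [set C | exists (v : vertex) (a : Sigma), C = [set t | t v = a]].

Definition coin_space := g_sigma_algebraType coin_gen.

End TreeSpace.

Definition is_coin_flipping (R : realType) (Sigma : finType) (a0 : Sigma)
    (P : probability (coin_space a0) R) : Prop :=
  forall s : seq (vertex * Sigma), uniq (map fst s) ->
    P [set t : coin_space a0 | forall va, va \in s -> t va.1 = va.2]
      = ((#|Sigma|%:R ^-1) ^+ size s)%:E.

Definition ga_language (Sigma Q : finType) (a0 : Sigma)
    (A : game_automaton Sigma Q) : set (coin_space a0) :=
  [set t | ga_accepts A t].
Arguments ga_language {Sigma Q} a0 A.

(* mu(X) = v, where mu is the completion of the measure P (X need not be
   measurable in the generated sigma-algebra, only in its completion). *)
Definition completed_value d (T : measurableType d) (R : realType)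
    (P : set T -> \bar R) (X : set T) (v : \bar R) : Prop :=
  exists A B : set T,
    [/\ measurable A, measurable B, A `<=` X, X `<=` B & (P A = v /\ P B = v)].

Inductive mbp_kind := KProb | KEx | KAll.

Record mbp (R : realType) := MBP {
  mbp_S : finType;
  mbp_E : rel mbp_S;
  mbp_kind_of : mbp_S -> mbp_kind;
  mbp_p : mbp_S -> mbp_S -> R;
  mbp_Par : mbp_S -> nat }.

Section BranchingPlays.
Variables (R : realType) (M : mbp R).
Local Notation S := (mbp_S M).
Local Notation E := (@mbp_E _ M).
Local Notation kind := (@mbp_kind_of _ M).
Local Notation p := (@mbp_p _ M).

Definition mbp_wf : Prop :=
  (forall s, exists s', E s s') /\
  (forall s, kind s = KProb ->
     [/\ forall s', 0 <= p s s', forall s', ~~ E s s' -> p s s' = 0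
       & \sum_(s' : S) p s s' = 1]).

(* A branching play is represented by its set of vertices; a vertex is
   identified with the sequence of state labels on the path from the root
   (the root is [:: s0], and the label of vertex w is last s0 w).  This is
   unambiguous since the children of a vertex carry pairwise distinct labels. *)
Definition bplay_carrier := seq S -> bool.

Definition bplay_gen : set (set bplay_carrier) :=
  [set C | exists (w : seq S) (b : bool), C = [set T | T w = b]].

Definition bplay_space := g_sigma_algebraType bplay_gen.

Definition is_bplay (s0 : S) (T : seq S -> bool) : Prop :=
  [/\ T [:: s0],
      forall w, T w -> w = [:: s0] \/
        exists w' c, [/\ w = rcons w' c, T w' & E (last s0 w') c],
      forall w, T w -> kind (last s0 w) = KProb ->
        exists c, T (rcons w c) /\ forall c', T (rcons w c') -> c' = c &
      forall w, T w -> kind (last s0 w) <> KProb ->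
        forall c, T (rcons w c) = E (last s0 w) c].

Fixpoint bprob (s0 : S) (T : seq S -> bool) (w : seq S) (n : nat) : R :=
  match n with
  | 0 => 1
  | n'.+1 =>
    let s := last s0 w in
    match kind s with
    | KProb => \sum_(c : S | T (rcons w c)) p s c * bprob s0 T (rcons w c) n'
    | _ => \prod_(c : S | E s c) bprob s0 T (rcons w c) n'
    end
  end.

(* mu_M: the law of the random branching play from s0, characterised by the
   probabilities of its finite prefixes (vertices of size <= n.+1, i.e. of
   depth <= n). *)
Definition is_mbp_measure (s0 : S) (P : probability bplay_space R) : Prop :=
  forall T0, is_bplay s0 T0 -> forall n : nat,
    P [set T : bplay_space | forall w, (size w <= n.+1)%N -> T w = T0 w]
      = (bprob s0 T0 [:: s0] n)%:E.

Definition bplay_win (s0 : S) (T : seq S -> bool) : Prop :=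
  exists sigma : seq S -> S,
    (forall w, T w -> kind (last s0 w) = KEx -> T (rcons w (sigma w))) /\
    forall u : nat -> S, u 0%N = s0 ->
      (forall n, T (mkseq u n.+1)) ->
      (forall n, kind (u n) = KEx -> u n.+1 = sigma (mkseq u n.+1)) ->
      parity_win (fun n => @mbp_Par _ M (u n)).

Definition bplay_winset (s0 : S) : set bplay_space := [set T | bplay_win s0 T].

End BranchingPlays.

Section CorrespondingMBP.
Variables (R : realType) (Sigma Q : finType) (A : game_automaton Sigma Q).

(* inl q is s_q ; inr (q, a) is s_{q,a} *)
Definition ga_mbp_S : finType := (Q + Q * Sigma)%type.

Definition ga_mbp_E : rel ga_mbp_S := fun x y =>
  match x, y with
  | inl q, inr (q', _) => q' == q
  | inr (q, a), inl q' =>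
      (q' == trans_next (ga_delta A q a) DL) ||
      (q' == trans_next (ga_delta A q a) DR)
  | _, _ => false
  end.

Definition ga_mbp_kind (x : ga_mbp_S) : mbp_kind :=
  match x with
  | inl _ => KProb
  | inr (q, a) => if trans_is_or (ga_delta A q a) then KEx else KAll
  end.

Definition ga_mbp_p (x y : ga_mbp_S) : R :=
  match x, y with
  | inl q, inr (q', _) => if q' == q then #|Sigma|%:R ^-1 else 0
  | _, _ => 0
  end.

Definition ga_mbp_Par (x : ga_mbp_S) : nat :=
  match x with inl q => ga_pri A q | inr (q, _) => ga_pri A q end.

Definition mbp_of_ga : mbp R :=
  MBP ga_mbp_E ga_mbp_kind ga_mbp_p ga_mbp_Par.

Definition s_state (q : Q) : mbp_S mbp_of_ga := inl q.

End CorrespondingMBP.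

(* Main.v *)
Require Import Defs.
From HB Require Import structures.
From mathcomp Require Import all_boot all_order all_algebra.
From mathcomp Require Import all_classical all_reals all_analysis.

(* Measurability.  On a fixed tree the acceptance game is a parity game on the
   binary tree, and its winning region is a nested fixpoint of monotone
   operators on sets of vertices.  These operators act tree by tree, and each
   least fixpoint preserves measurability up to null sets: the largest
   measurable minorant of the fixpoint, which exists up to null sets, is almost
   everywhere a prefixed point, hence almost everywhere the fixpoint itself.
   This replaces transfinite approximation of the fixpoint.

   Equality.  Since qL <> qR, sending t to the branching play with the choices
   of t is a bijection from trees onto branching plays that preserves the winner
   and identifies cylinders of depth k with prefixes of depth 2k.  Both have
   probability |Sigma|^-(2^k - 1), so the branching plays have full measure and
   the inverse bijection sends the law of the branching play to the coin-flipping
   measure. *)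

Set Implicit Arguments.
Unset Strict Implicit.
Unset Printing Implicit Defensive.

Import Order.TTheory GRing.Theory Num.Theory.
Local Open Scope classical_set_scope.

(** * Parity games on the binary tree as nested fixpoints *)

Definition lfp T (F : set T -> set T) : set T :=
  [set x | forall Z, F Z `<=` Z -> Z x].

(** Taken as the dual of [lfp], so that facts about greatest fixpoints reduce to facts about least
    ones by complementation. *)
Definition gfp T (F : set T -> set T) : set T := ~` lfp (fun Z => ~` F (~` Z)).

Definition increasing_op T (F : set T -> set T) :=
  forall Z Z', Z `<=` Z' -> F Z `<=` F Z'.

Lemma lfp_le T (F : set T -> set T) Z : F Z `<=` Z -> lfp F `<=` Z.
Proof. by move=> FZ x; exact. Qed.

Lemma lfp_prefixed T (F : set T -> set T) : increasing_op F -> F (lfp F) `<=` lfp F.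
Proof. by move=> mF x Fx Z FZ; apply/FZ/(mF _ _ (lfp_le FZ)). Qed.

Lemma gfpP T (F : set T -> set T) x :
  gfp F x <-> exists2 Z, Z `<=` F Z & Z x.
Proof.
split=> [/existsNP[Z /not_implyP[FZ nZx]]|[Z ZF Zx] /(_ (~` Z))].
  by exists (~` Z) => // y nZy; apply: contrapT => /FZ.
by rewrite setCK; apply => //; exact: subsetC.
Qed.

(** The parameter [b] lets one argument serve both players: [false] is the winning parity of Exists,
    [true] that of Forall. *)
Definition parity_wins (b : bool) (c : nat -> nat) : Prop :=
  exists m : nat, [/\ odd m = b,
    (forall N, exists2 n, (N <= n)%N & c n = m) &
    (exists N, forall n, (N <= n)%N -> (c n <= m)%N)].

Lemma parity_winsE c : parity_wins false c <-> parity_win c.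
Proof.
by split=> -[m [mo h1 h2]]; exists m; split=> //; move: mo; case: (odd m).
Qed.

Lemma parity_wins_shift b c j :
  parity_wins b (fun k => c (j + k)%N) -> parity_wins b c.
Proof.
move=> [m [mo inf [N bnd]]]; exists m; split=> //.
  move=> N'; have [k Nk ck] := inf N'; exists (j + k)%N => //.
  exact: leq_trans Nk (leq_addl _ _).
exists (j + N)%N => n jNn; rewrite -(subnKC (leq_trans (leq_addr N j) jNn)).
by apply: bnd; rewrite leq_subRL// (leq_trans (leq_addr N j) jNn).
Qed.

Lemma parity_wins_excl b c : parity_wins b c -> parity_wins (~~ b) c -> False.
Proof.
move=> [m [mo inf [N bnd]]] [m' [mo' inf' [N' bnd']]].
have mm' : (m <= m')%N by have [n Nn <-] := inf N'; exact: bnd'.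
have m'm : (m' <= m)%N by have [n Nn <-] := inf' N; exact: bnd.
have e : m = m' by apply/eqP; rewrite eqn_leq mm' m'm.
by move: mo'; rewrite -e mo; case: (b).
Qed.

Section TreeGame.
Implicit Types (b : bool) (c : vertex -> nat) (o : vertex -> bool).
Implicit Types (X Z : set vertex) (x y : vertex) (d : nat -> dir).

(* In [stage b c o n X] the player owning [o], with winning parity [b], plays
   until the first vertex, after at least one move, of priority at least [n];
   she wins there iff that vertex is in [X], and wins an infinite play of
   priorities less than [n] by the parity condition. *)
Fixpoint stage b c o n X : set vertex :=
  match n with
  | 0 => [set x | if o x then exists i, X (rcons x i)
                  else forall i, X (rcons x i)]
  | m.+1 =>
    let F Z := stage b c o m [set y | if c y == m then Z y else X y] in
    if odd m == b then gfp F else lfp F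
  end.

Lemma stage_monotone b c o n : increasing_op (stage b c o n).
Proof.
elim: n => [|n IH] X X' XX' x /=.
  by case: (o x) => [[i Xi]|h]; [exists i; exact: XX'|move=> i; exact: XX'].
have sub Z : stage b c o n [set y | if c y == n then Z y else X y] `<=`
             stage b c o n [set y | if c y == n then Z y else X' y].
  by apply: IH => y /=; case: ifP => // _; exact: XX'.
case: ifP => _.
  move/gfpP=> [Z ZF Zx]; apply/gfpP; exists Z => //.
  exact: subset_trans ZF (sub _).
by move=> h Z FZ; apply: h; exact: subset_trans (sub _) FZ.
Qed.

Lemma stage_step_monotone b c o n X :
  increasing_op (fun Z => stage b c o n [set y | if c y == n then Z y else X y]).
Proof.
by move=> Z Z' ZZ'; apply: stage_monotone => y /=; case: ifP => // _; exact: ZZ'.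
Qed.

(** Complementation exchanges a choice of one child with a demand on both, and [lfp] with [gfp].
    This supplies determinacy and later reduces measurability of [gfp] stages to [lfp] stages. *)
Lemma stage_dual b c o n X :
  stage (~~ b) c (fun x => ~~ o x) n X = ~` stage b c o n (~` X).
Proof.
elim: n X => [|n IH] X /=.
  apply/seteqP; split=> x /=; case: (o x) => /= h.
  - by move=> [i]; exact.
  - by case: h => i Xi /(_ i).
  - by move=> i; apply: contrapT => nX; apply: h; exists i.
  - by apply: contrapT => nX; apply: h => i Xi; apply: nX; exists i.
have E (Z : set vertex) :
    stage (~~ b) c (fun x => ~~ o x) n [set y | if c y == n then Z y else X y] =
  ~` stage b c o n [set y | if c y == n then (~` Z) y else (~` X) y].
  rewrite IH; congr (~` stage _ _ _ _ _).
  by apply/seteqP; split=> y /=; case: ifP.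
have -> : (odd n == ~~ b) = ~~ (odd n == b) by case: (odd n); case: (b).
case: (odd n == b) => /=.
  rewrite /gfp setCK; congr lfp; apply/funext => Z.
  exact: E.
rewrite /gfp; congr (~` lfp _); apply/funext => Z.
by rewrite E !setCK.
Qed.

(** * Plays and restarting strategies *)

Definition pos x d k : vertex := x ++ mkseq d k.

Lemma pos0 x d : pos x d 0 = x. Proof. exact: cats0. Qed.

Lemma posS x d k : pos x d k.+1 = rcons (pos x d k) (d k).
Proof. by rewrite /pos mkseqS rcons_cat. Qed.

Lemma size_pos x d k : size (pos x d k) = (size x + k)%N.
Proof. by rewrite size_cat size_mkseq. Qed.

Lemma pos_shift x d j k :
  pos (pos x d j) (fun i => d (j + i)%N) k = pos x d (j + k).
Proof.
elim: k => [|k IH]; first by rewrite pos0 addn0.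
by rewrite posS IH addnS posS.
Qed.

Lemma take_pos x d j m : (j <= m)%N -> take (size x + j) (pos x d m) = pos x d j.
Proof.
move=> jm; rewrite -(subnKC jm) -pos_shift [in LHS]/pos take_cat size_pos.
by rewrite ltnn subnn take0 cats0.
Qed.

(** The index [j.+1] leaves out the starting vertex: a play that begins at priority [n] or more must
    still make a move. *)
Definition alive c n x d k := forall j, (j < k)%N -> (c (pos x d j.+1) < n)%N.

(* Consistency with the strategy is only required until the play stops: what
   happens afterwards is irrelevant, and finite plays need no extension. *)
Definition consistent c o n (sigma : vertex -> dir) x d :=
  forall k, alive c n x d k -> o (pos x d k) -> d k = sigma (pos x d k).

Definition outcome b c n X x d :=
  (exists2 k, alive c n x d k & (n <= c (pos x d k.+1))%N /\ X (pos x d k.+1))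
  \/ ((forall k, alive c n x d k) /\ parity_wins b (fun k => c (pos x d k))).

Definition wins b c o n X : set vertex := [set x |
  exists sigma, forall d, consistent c o n sigma x d -> outcome b c n X x d].

(* The vertex at which the strategy in force at [y] was adopted by a player who
   starts at [x] and restarts (only once, if [once]) at priority [n]. *)
Fixpoint restart (once : bool) c n x y k : vertex :=
  if k is j.+1 then
    let r := restart once c n x y j in
    let z := take (size x + k) y in
    if (c z == n) && (~~ once || (r == x)) then z else r
  else x.

Definition restart_strategy once c n x (s : vertex -> vertex -> dir) y : dir :=
  s (restart once c n x y (size y - size x)) y.

Lemma restart_pos once c n x d m k : (k <= m)%N ->
  restart once c n x (pos x d m) k = restart once c n x (pos x d k) k.
Proof.
suff H j m' m'' : (j <= m')%N -> (j <= m'')%N ->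
    restart once c n x (pos x d m') j = restart once c n x (pos x d m'') j.
  by move=> km; exact: H.
elim: j => //= j IH jm' jm''.
by rewrite (IH (ltnW jm') (ltnW jm'')) !take_pos.
Qed.

Lemma restart_strategyE once c n x s d k :
  restart_strategy once c n x s (pos x d k) =
  s (restart once c n x (pos x d k) k) (pos x d k).
Proof. by rewrite /restart_strategy size_pos addKn. Qed.

Lemma restartS once c n x d k :
  let r := restart once c n x (pos x d k) k in
  restart once c n x (pos x d k.+1) k.+1 =
  if (c (pos x d k.+1) == n) && (~~ once || (r == x)) then pos x d k.+1 else r.
Proof. by move=> r; rewrite /= take_pos// restart_pos. Qed.

Lemma restart_const once c n x d j l :
  (forall i, (i < l)%N -> c (pos x d (j + i).+1) <> n) ->
  restart once c n x (pos x d (j + l)) (j + l) =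
  restart once c n x (pos x d j) j.
Proof.
elim: l => [|l IH] h; first by rewrite addn0.
rewrite addnS restartS; case: eqP => [/h|_] /=; first by move=> /(_ (ltnSn l)).
by apply: IH => i il; apply: h; exact: ltnW.
Qed.

Lemma alive_add c n x d j l :
  alive c n x d j -> alive c n (pos x d j) (fun i => d (j + i)%N) l ->
  alive c n x d (j + l).
Proof.
move=> aj al i ijl; case: (ltnP i j) => [/aj//|ji].
have il : (i - j < l)%N by rewrite ltn_subLR.
by have := al _ il; rewrite pos_shift addnS subnKC.
Qed.

Lemma alive_le c m n x d k : (m <= n)%N -> alive c m x d k -> alive c n x d k.
Proof. by move=> mn a j jk; exact: leq_trans (a j jk) mn. Qed.

Lemma alive_pred c n x d k k' : (k' <= k)%N -> alive c n x d k -> alive c n x d k'.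
Proof. by move=> kk' a j jk; exact: a (leq_trans jk kk'). Qed.

Lemma aliveS c n x d k : alive c n x d k -> (c (pos x d k.+1) < n)%N ->
  alive c n x d k.+1.
Proof. by move=> a ck j; rewrite ltnS leq_eqVlt => /orP[/eqP->|/a]. Qed.

(* As long as no vertex of priority [n] shows up after [j], the restarting
   strategy follows the strategy in force at [j]. *)
Lemma consistent_restart once c o n x s d j r :
  consistent c o n.+1 (restart_strategy once c n x s) x d ->
  alive c n.+1 x d j -> restart once c n x (pos x d j) j = r ->
  consistent c o n (s r) (pos x d j) (fun i => d (j + i)%N).
Proof.
move=> cons aj rj k ak; rewrite pos_shift => ok.
rewrite cons//; last exact: alive_add aj (alive_le (leqnSn n) ak).
rewrite restart_strategyE restart_const ?rj// => i ik.
by have := ak i ik; rewrite pos_shift addnS => /[swap] ->; rewrite ltnn.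
Qed.

(** Restart at every visit to priority [n]. If the restarts end, the last strategy adopted wins the
    rest of the play; otherwise [n] is the largest priority seen infinitely often and has the right
    parity. *)
Lemma wins_gfp b c o n X Z : odd n = b ->
  Z `<=` wins b c o n [set y | if c y == n then Z y else X y] ->
  Z `<=` wins b c o n.+1 X.
Proof.
move=> nb ZF x Zx.
have /choice[s sP] z : exists s, Z z -> forall d, consistent c o n s z d ->
    outcome b c n [set y | if c y == n then Z y else X y] z d.
  have [/ZF[s sP]|nZ] := pselect (Z z); first by exists s.
  by exists (fun=> DL).
exists (restart_strategy false c n x s) => d cons; apply: contrapT => nout.
(* At a good index the strategy in force was adopted at the current position, in [Z]. Since the play
   is assumed not to be won, each good index leads to a later one. *)
pose good j := [/\ alive c n.+1 x d j, Z (pos x d j) &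
  restart false c n x (pos x d j) j = pos x d j].
have next j : good j ->
    exists l, good (j + l).+1 /\ c (pos x d (j + l).+1) = n.
  move=> [aj Zj rj].
  have [[l al [cl Xl]]|[al win]] := sP _ Zj _ (consistent_restart cons aj rj).
    have al' := alive_add aj (alive_le (leqnSn n) al).
    move: cl Xl; rewrite pos_shift /= addnS; case: eqP => [cl _ Zl|/eqP cn cl Xl].
      exists l; split=> //; split=> //; first by apply: aliveS => //; rewrite cl.
      by rewrite restartS cl eqxx.
    exfalso; apply: nout; left; exists (j + l)%N => //; split=> //.
    by rewrite ltn_neqAle eq_sym cn.
  exfalso; apply: nout; right; split.
    move=> k; apply: (@alive_pred _ _ _ _ (j + k)%N); first exact: leq_addl.
    by apply: alive_add => //; apply: alive_le (al k).
  apply: (parity_wins_shift (j := j)); move: win; congr parity_wins.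
  by apply/funext => k; rewrite pos_shift.
(* The start lies in [Z] but may have another priority than [n], hence the guard [0 < N]. *)
have inf N : exists j, (N <= j)%N /\ good j /\ ((0 < N)%N -> c (pos x d j) = n).
  elim: N => [|N [j [Nj [gj _]]]].
    by exists 0%N; do !split=> //; rewrite ?pos0.
  have [l [gl cl]] := next j gj; exists (j + l).+1; split=> //.
  by rewrite ltnS (leq_trans Nj)// leq_addr.
have al k : alive c n.+1 x d k.
  by have [j [kj [[aj _ _] _]]] := inf k; exact: alive_pred kj aj.
apply: nout; right; split=> //; exists n; split=> //.
  by move=> N; have [j [Nj [_ cj]]] := inf N.+1; exists j; [exact: ltnW|exact: cj].
exists 1%N => -[//|k] _; exact: (al k.+1 k).
Qed.

(** Follow the first strategy until priority [n] appears, then switch for good to one that wins from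
    there. Thus [wins b c o n.+1 X] is a prefixed point once stages are known to be winning, and
    contains the least one. *)
Lemma wins_lfp b c o n X :
  wins b c o n [set y | if c y == n then wins b c o n.+1 X y else X y] `<=`
  wins b c o n.+1 X.
Proof.
move=> x [s0 s0P].
have /choice[s1 s1P] z : exists s, wins b c o n.+1 X z -> forall d,
    consistent c o n.+1 s z d -> outcome b c n.+1 X z d.
  have [[s sP]|nZ] := pselect (wins b c o n.+1 X z); first by exists s.
  by exists (fun=> DL).
pose s z := if z == x then s0 else s1 z.
exists (restart_strategy true c n x s) => d cons.
have a0 : alive c n.+1 x d 0 by [].
have := @consistent_restart true c o n x s d 0 x cons a0.
rewrite pos0 => /(_ erefl); rewrite {1}/s eqxx.
have -> : (fun i => d (0 + i)%N) = d by [].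
move=> /s0P[[l al [cl Xl]]|[al win]]; last first.
  by right; split=> // k; exact: alive_le (al k).
move: Xl => /=; case: eqP => [cln winl|/eqP cn Xl]; last first.
  left; exists l; first exact: alive_le al.
  by split=> //; rewrite ltn_neqAle eq_sym cn.
set y := pos x d l.+1 in winl cln.
have al1 : alive c n.+1 x d l.+1.
  by apply: aliveS; [exact: alive_le al|rewrite -/y cln].
(* A play never returns to its start, so the test [r == x] in [restart] means that no switch has
   occurred yet. *)
have yx : y != x.
  apply/eqP => /(congr1 size); rewrite size_pos => /eqP.
  by rewrite -[X in _ == X]addn0 eqn_add2l.
have ry k : restart true c n x (pos x d (l.+1 + k)) (l.+1 + k) = y.
  elim: k => [|k IH]; last by rewrite addnS restartS IH (negPf yx) andbF.
  rewrite addn0 restartS -/y cln eqxx /=.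
  have := @restart_const true c n x d 0 l; rewrite !add0n => ->; last first.
    by move=> i il ci; have := al i il; rewrite ci ltnn.
  by rewrite pos0 eqxx.
have : consistent c o n.+1 (s1 y) y (fun i => d (l.+1 + i)%N).
  move=> k ak; rewrite pos_shift => ok; rewrite cons//; last exact: alive_add.
  by rewrite restart_strategyE ry /s (negPf yx).
move=> /(s1P _ winl)[[k ak]|[ak win]].
  rewrite pos_shift addnS => cX; left; exists (l.+1 + k)%N => //.
  exact: alive_add.
right; split.
  move=> k; apply: (@alive_pred _ _ _ _ (l.+1 + k)%N); first exact: leq_addl.
  exact: alive_add.
apply: (parity_wins_shift (j := l.+1)); move: win; congr parity_wins.
by apply/funext => k; rewrite pos_shift.
Qed.

(** Strategies are built only for this inclusion; the converse comes from [stage_dual]. *)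
Lemma stage_wins b c o n X : stage b c o n X `<=` wins b c o n X.
Proof.
elim: n X => [|n IH] X x /=.
  case: ifP => [ox [i Xi]|ox h]; [exists (fun=> i)|exists (fun=> DL)] => d cons;
    left; exists 0%N => //; split=> //; rewrite posS pos0//.
  by rewrite cons// pos0.
case: eqP => [nb /gfpP[Z ZF]|_].
  by apply: (wins_gfp nb) => z /ZF; exact: IH.
apply: lfp_le; apply: subset_trans (@wins_lfp _ _ _ _ _); exact: IH.
Qed.

(** Let the two strategies play each other: the play never stops, and would be won with both
    parities. *)
Lemma wins_excl b c o n x : (forall y, (c y < n)%N) ->
  wins b c o n setT x -> wins (~~ b) c (fun y => ~~ o y) n setT x -> False.
Proof.
move=> cn [s sP] [s' sP'].
pose p := fix p k := if k is k'.+1 then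
  rcons (p k') (if o (p k') then s (p k') else s' (p k')) else x.
pose d k := if o (p k) then s (p k) else s' (p k).
have pE k : pos x d k = p k.
  by elim: k => [|k IH]; rewrite ?pos0 // posS IH.
have [] : outcome b c n setT x d.
- by apply: sP => k _; rewrite pE /d => ->.
- by move=> [k _ []]; rewrite leqNgt cn.
move=> [_ w].
have [] : outcome (~~ b) c n setT x d.
- by apply: sP' => k _; rewrite pE /d => /negPf ->.
- by move=> [k _ []]; rewrite leqNgt cn.
by move=> [_ w']; exact: parity_wins_excl w w'.
Qed.

Lemma wins_setT b c o n X : wins b c o n X `<=` wins b c o n setT.
Proof.
move=> x [s sP]; exists s => d /sP[[k ak [ck _]]|]; last by right.
by left; exists k.
Qed.

(** Outside the stage its dual holds, so the opponent wins by [stage_wins], contradicting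
    [wins_excl]. No play stops, so the targets [setT] and [set0] can be exchanged. *)
Lemma wins_stage b c o n x : (forall y, (c y < n)%N) ->
  wins b c o n setT x <-> stage b c o n set0 x.
Proof.
move=> cn; split=> [w|/stage_wins/wins_setT//]; apply: contrapT => nst.
apply: (wins_excl cn w); apply/(@wins_setT _ _ _ _ setT)/stage_wins.
by rewrite stage_dual setCT.
Qed.

End TreeGame.

(** * Measurability of least fixpoints up to null sets *)

Section CompletedMeasurability.
Context {d : measure_display} {T : measurableType d} {R : realType}.
Variable P : probability T R.
Implicit Types A B S : set T.

(** This is measurability for the completion of [P]: adding a measurable null cover of the
    difference turns the inner approximation into an outer one. *)
Definition completely_measurable S :=
  exists A, [/\ measurable A, A `<=` S & P.-negligible (S `\` A)].

Lemma completely_measurableW A : measurable A -> completely_measurable A.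
Proof. by move=> mA; exists A; split=> //; rewrite setDv; exact: negligible_set0. Qed.

Lemma completely_measurableC S :
  completely_measurable S -> completely_measurable (~` S).
Proof.
move=> [A [mA AS [N [mN N0 SAN]]]]; exists (~` (A `|` N)); split.
- exact/measurableC/measurableU.
- move=> x nAN Sx; apply: nAN; have [|nA] := pselect (A x); first by left.
  by right; exact: SAN.
- exists N; split=> // x [nSx /contrapT[/AS//|]]; exact.
Qed.

Lemma completely_measurable_bigcup (F : nat -> set T) :
  (forall i, completely_measurable (F i)) -> completely_measurable (\bigcup_i F i).
Proof.
move=> /choice[A AP]; exists (\bigcup_i A i); split.
- by apply: bigcupT_measurable => i; have [] := AP i.
- by apply: subset_bigcup => i _; have [] := AP i.
- apply: (@negligibleS _ _ _ _ (\bigcup_i (F i `\` A i))).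
    by move=> x [[i _ Fix] nA]; exists i => //; split=> // Aix; apply: nA; exists i.
  by apply: negligible_bigcup => i; have [] := AP i.
Qed.

Lemma completely_measurableU S S' : completely_measurable S ->
  completely_measurable S' -> completely_measurable (S `|` S').
Proof.
move=> mS mS'; rewrite -bigcup2E; apply: completely_measurable_bigcup => -[|[|i]] //=.
exact: completely_measurableW.
Qed.

Lemma completely_measurableI S S' : completely_measurable S ->
  completely_measurable S' -> completely_measurable (S `&` S').
Proof.
move=> /completely_measurableC mS /completely_measurableC mS'.
rewrite -(setCK (S `&` S')) setCI.
exact/completely_measurableC/completely_measurableU.
Qed.

Lemma completely_measurable_value S : completely_measurable S ->
  exists v, completed_value P S v.
Proof.
move=> [A [mA AS [N [mN N0 SAN]]]]; exists (P A), A, (A `|` N); split=> //.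
- exact: measurableU.
- move=> x Sx; have [|nA] := pselect (A x); [by left|right; exact: SAN].
- by split=> //; exact: measureU0.
Qed.

(** Unite measurable subsets of [S] whose measures approach the supremum; a further piece of
    positive measure would exceed it. *)
Lemma measurable_kernel S : exists A, [/\ measurable A, A `<=` S &
  forall B, measurable B -> B `<=` S -> P (B `\` A) = 0%E].
Proof.
pose V := [set P A | A in [set A | measurable A /\ A `<=` S]].
have V0 : V 0%E.
  by exists set0; [split=> //; exact: sub0set|exact: measure0].
have supfin : ereal_sup V \is a fin_num.
  rewrite ge0_fin_numE; last exact: ereal_sup_ubound.
  apply: (@le_lt_trans _ _ 1%E); last exact: ltry.
  by apply: ge_ereal_sup => _ [A [mA _] <-]; exact: probability_le1.
have /choice[A AP] n : exists A, [/\ measurable A, A `<=` S &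
    (ereal_sup V - (n.+1%:R^-1)%:E < P A)%E].
  have [|_ [A [mA AS] <-] lt] := @ub_ereal_sup_adherent R V n.+1%:R^-1%R _ supfin.
    by rewrite invr_gt0 ltr0n.
  by exists A.
have mA : measurable (\bigcup_n A n).
  by apply: bigcupT_measurable => n; have [] := AP n.
have AS : \bigcup_n A n `<=` S by apply: bigcup_sub => n _; have [] := AP n.
exists (\bigcup_n A n); split=> // B mB BS.
have supA : (ereal_sup V <= P (\bigcup_n A n))%E.
  apply/lee_addgt0Pr => e e0.
  have [n ne] : exists n : nat, (n.+1%:R^-1 <= e :> R)%R.
    have [n _ h] := near_infty_natSinv_lt (PosNum e0).
    by exists n; apply/ltW/(h n) => /=.
  have [mAn _ lt] := AP n.
  rewrite lteBlDr// in lt; apply/ltW/(lt_le_trans lt)/leeD; last by rewrite lee_fin.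
  by apply: le_measure; rewrite ?inE//; exact: bigcup_sup.
have mBA := measurableD mB mA.
have : (P (\bigcup_n A n) + P (B `\` \bigcup_n A n) <= P (\bigcup_n A n))%E.
  rewrite -measureU//; last by apply/seteqP; split=> // x [Ax []].
  apply: le_trans supA; apply: ereal_sup_ubound.
  exists (\bigcup_n A n `|` (B `\` \bigcup_n A n)) => //.
  split; first exact: measurableU.
  by rewrite subUset; split=> //; apply: subset_trans BS; exact: subDsetl.
have fA : P (\bigcup_n A n) \is a fin_num by exact: fin_num_measure.
rewrite -leeBrDl// subee// => le0.
by apply/eqP; rewrite eq_le le0 measure_ge0.
Qed.

(* The measurable kernel [A v] of the section [L v] of the fixpoint is also a
   prefixed point of [F], almost everywhere: [F] maps the family [A] to
   completely measurable subsets of [L], hence into [A] up to null sets. *)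
Lemma completely_measurable_lfp (V : countType)
    (F : T -> set V -> set V) : (forall t, increasing_op (F t)) ->
  (forall X : T -> set V, (forall v, completely_measurable [set t | X t v]) ->
     forall v, completely_measurable [set t | F t (X t) v]) ->
  forall v, completely_measurable [set t | lfp (F t) v].
Proof.
move=> mF Fmeas; pose L v := [set t | lfp (F t) v].
have /choice[A AP] v := measurable_kernel (L v).
pose X t := [set v | A v t].
have XL t : X t `<=` lfp (F t) by move=> v Avt; have [_ AL _] := AP v; exact: AL.
have /choice[B BP] v : exists B, [/\ measurable B, B `<=` [set t | F t (X t) v] &
    P.-negligible ([set t | F t (X t) v] `\` B)].
  by apply: Fmeas => w; apply: completely_measurableW; have [] := AP w.
(* The points where [X] fails at [v] to be a prefixed point. The part inside [B v] is null by
   maximality of [A v], the rest by the choice of [B v]. *)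
pose N v := [set t | F t (X t) v] `\` A v.
have N0 v : P.-negligible (N v).
  have [mA AL Amax] := AP v; have [mB BF B0] := BP v.
  apply: (@negligibleS _ _ _ _
    (B v `\` A v `|` ([set t | F t (X t) v] `\` B v))).
    by move=> t [Ft nA]; have [Bt|nBt] := pselect (B v t); [left|right].
  apply: negligibleU => //; apply/negligibleP; first exact: measurableD.
  apply: Amax => // t /BF /(mF _ _ _ (XL t)); exact: lfp_prefixed.
have NU : P.-negligible (\bigcup_n
    (if unpickle n is Some v then N v else set0)).
  by apply: negligible_bigcup => n; case: unpickle => // ; exact: negligible_set0.
move=> v; have [mA AL _] := AP v; exists (A v); split=> //.
apply: (negligibleS _ NU) => t [Lt nA]; apply: contrapT => nN; apply: nA.
(* Off the countably many null sets [N v], [X t] is a prefixed point and so contains the least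
   fixpoint. *)
suff FX : F t (X t) `<=` X t by exact: (lfp_le FX Lt).
move=> w Fw; apply: contrapT => nAw; apply: nN.
by exists (pickle w) => //; rewrite pickleK.
Qed.

(** The induction ranges over [b] and [o] because a [gfp] stage is treated as the complement of an
    [lfp] stage of the opponent. *)
Lemma completely_measurable_stage b (c : T -> vertex -> nat)
    (o : T -> vertex -> bool) n :
  (forall x, measurable [set t | o t x]) ->
  (forall x m, measurable [set t | c t x = m]) ->
  forall X : T -> set vertex, (forall x, completely_measurable [set t | X t x]) ->
  forall x, completely_measurable [set t | stage b (c t) (o t) n (X t) x].
Proof.
move=> mo mc; elim: n b o mo => [|n IH] b o mo X mX x.
  have mo' := completely_measurableW (mo x).
  suff -> : [set t | stage b (c t) (o t) 0 (X t) x] =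
    [set t | o t x] `&`
      ([set t | X t (rcons x DL)] `|` [set t | X t (rcons x DR)]) `|`
    ~` [set t | o t x] `&`
      ([set t | X t (rcons x DL)] `&` [set t | X t (rcons x DR)]).
    apply: completely_measurableU; apply: completely_measurableI => //.
    - exact: completely_measurableU.
    - exact: completely_measurableC.
    - exact: completely_measurableI.
  apply/seteqP; split=> t /=; case: (o t x).
  - by move=> [[] Xi]; left; split=> //; [left|right].
  - by move=> h; right.
  - by move=> [[_ [Xi|Xi]]|[]//]; [exists DL|exists DR].
  - by move=> [[]//|[_ [h1 h2]]] [].
have lfp_case b' (o' : T -> vertex -> bool) (X' : T -> set vertex) : (forall y, measurable [set t | o' t y]) ->
    (forall y, completely_measurable [set t | X' t y]) ->
    completely_measurable [set t | lfp (fun Z => stage b' (c t) (o' t) n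
      [set y | if c t y == n then Z y else X' t y]) x].
  move=> mo' mX'; apply: completely_measurable_lfp.
    by move=> t; exact: stage_step_monotone.
  move=> Y mY; apply: IH => // y.
  have mcy := completely_measurableW (mc y n).
  rewrite [X in completely_measurable X](_ : _ =
    ([set t | c t y = n] `&` [set t | Y t y]) `|`
    (~` [set t | c t y = n] `&` [set t | X' t y])); last first.
    apply/seteqP; split=> t /=; case: eqP => h.
    - by left.
    - by right.
    - by move=> [[]|[]].
    - by move=> [[]|[]].
  apply: completely_measurableU; apply: completely_measurableI => //.
  exact: completely_measurableC.
have [nb|nb] := boolP (odd n == b); last first.
  under eq_set do rewrite /= (negPf nb).
  exact: lfp_case.
rewrite -[X in completely_measurable X]setCK; apply: completely_measurableC.
rewrite [X in completely_measurable X](_ : _ = [set t |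
    stage (~~ b) (c t) (fun y => ~~ o t y) n.+1 (~` X t) x]); last first.
  by apply/seteqP; split=> t; rewrite /mkset stage_dual setCK.
have /negPf nb' : odd n != ~~ b by rewrite (eqP nb); case: (b).
under eq_set do rewrite /= nb'.
apply: (lfp_case _ (fun t y => ~~ o t y) (fun t => ~` X t)).
  move=> y; rewrite [X in measurable X](_ : _ = ~` [set t | o t y]).
    exact: measurableC.
  by apply/seteqP; split=> t /negP.
by move=> y; exact: (completely_measurableC (mX y)).
Qed.

End CompletedMeasurability.

(** * The language of a game automaton *)

Section Language.
Variables (Sigma Q : finType) (A : game_automaton Sigma Q).
Implicit Types (t : vertex -> Sigma) (x : vertex).

Lemma ga_state_nil t : ga_state A t [::] = ga_q0 A.
Proof. by []. Qed.

Lemma ga_state_rcons t x d : ga_state A t (rcons x d) =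
  trans_next (ga_delta A (ga_state A t x) (t x)) d.
Proof.
(* The induction generalises the prefix already read, so [t x] is first written as the letter at
   [[::] ++ x]. *)
rewrite /ga_state -[in t x](cat0s x).
elim: x [::] (ga_q0 A) => [|i x IH] pre q /=; first by rewrite cats0.
by rewrite IH cat_rcons.
Qed.

Lemma eq_ga_state t u k : (forall y, (size y < k)%N -> t y = u y) ->
  forall x, (size x <= k)%N -> ga_state A t x = ga_state A u x.
Proof.
move=> tu; elim/last_ind => [//|x d IH]; rewrite size_rcons => xk.
by rewrite !ga_state_rcons tu// IH// ltnW.
Qed.

Definition ga_prio t x := ga_pri A (ga_state A t x).
Definition ga_owner t x := trans_is_or (ga_delta A (ga_state A t x) (t x)).

(** A strict bound on priorities: at this rank no play stops and the target of [stage] is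
    immaterial. *)
Definition ga_rank := (\max_(q : Q) ga_pri A q).+1.

Lemma ga_prio_lt t x : (ga_prio t x < ga_rank)%N.
Proof. by rewrite ltnS; exact: leq_bigmax. Qed.

Lemma ga_acceptsE t : ga_accepts A t <->
  stage false (ga_prio t) (ga_owner t) ga_rank set0 [::].
Proof.
rewrite -wins_stage; last exact: ga_prio_lt.
have al d k : alive (ga_prio t) ga_rank [::] d k by move=> j _; exact: ga_prio_lt.
split=> -[sigma sP]; exists sigma => d cons.
  right; split=> //; apply/parity_winsE; apply: sP => n x xo.
  exact: cons.
have [|[k _ []]|[_ /parity_winsE//]] := sP d.
- by move=> k _ ko; exact: cons.
- by rewrite leqNgt ga_prio_lt.
Qed.

Variable a0 : Sigma.

Lemma measurable_letter v a : measurable [set t : coin_space a0 | t v = a].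
Proof. by apply: sub_sigma_algebra; exists v, a. Qed.

Lemma measurable_state x q : measurable [set t : coin_space a0 | ga_state A t x = q].
Proof.
elim/last_ind: x q => [|x d IH] q.
  have [<-|qq0] := eqVneq (ga_q0 A) q.
    by rewrite [X in measurable X](_ : _ = setT); [exact: measurableT|apply/seteqP].
  rewrite [X in measurable X](_ : _ = set0); first exact: measurable0.
  by apply/seteqP; split=> t //=; rewrite ga_state_nil => /eqP; rewrite (negPf qq0).
rewrite [X in measurable X](_ : _ = \bigcup_(qa in
    [set qa : Q * Sigma | trans_next (ga_delta A qa.1 qa.2) d = q])
    ([set t : coin_space a0 | ga_state A t x = qa.1] `&`
     [set t : coin_space a0 | t x = qa.2])).
  apply: fin_bigcup_measurable; first exact: finite_finset.
  by move=> [q' a] _; apply: measurableI; [exact: IH|exact: measurable_letter].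
apply/seteqP; split=> t /=.
  by rewrite ga_state_rcons => h; exists (ga_state A t x, t x).
by move=> [[q' a] /= <- [<- <-]]; rewrite ga_state_rcons.
Qed.

Lemma measurable_state_letter x (C : Q -> Sigma -> Prop) :
  measurable [set t : coin_space a0 | C (ga_state A t x) (t x)].
Proof.
rewrite [X in measurable X](_ : _ = \bigcup_(qa in [set qa | C qa.1 qa.2])
    ([set t : coin_space a0 | ga_state A t x = qa.1] `&`
     [set t : coin_space a0 | t x = qa.2])).
  apply: fin_bigcup_measurable; first exact: finite_finset.
  by move=> [q a] _; apply: measurableI; [exact: measurable_state|
                                          exact: measurable_letter].
apply/seteqP; split=> t /=; first by move=> h; exists (ga_state A t x, t x).
by move=> [[q a] /= Cqa [-> ->]].
Qed.

Lemma completely_measurable_language (R : realType)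
    (mu : probability (coin_space a0) R) :
  completely_measurable mu (ga_language a0 A).
Proof.
rewrite [X in completely_measurable _ X](_ : _ = [set t : coin_space a0 |
    stage false (ga_prio t) (ga_owner t) ga_rank set0 [::]]); last first.
  by apply/seteqP; split=> t /ga_acceptsE.
apply: (@completely_measurable_stage _ _ _ _ false (fun t : coin_space a0 => ga_prio t)
  (fun t => ga_owner t) _ _ _ (fun=> set0)).
- by move=> x; exact: (measurable_state_letter x (fun q a => trans_is_or (ga_delta A q a))).
- by move=> x m; exact: (measurable_state_letter x (fun q _ => ga_pri A q = m)).
- by move=> x; apply: completely_measurableW; exact: measurable0.
Qed.

End Language.

(** * Branching plays as trees *)

Lemma rcons_eq (T : Type) (s s' : seq T) a a' :
  rcons s a = rcons s' a' -> s = s' /\ a = a'.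
Proof. by case/rcons_inj. Qed.

(** Each tree vertex gives two consecutive vertices of the branching play, of equal priority. *)
Lemma parity_win_half c : parity_win (fun n => c n./2) <-> parity_win c.
Proof.
split=> -[m [mo inf [N bnd]]]; exists m; split=> //.
- move=> K; have [n Kn <-] := inf K.*2; exists n./2 => //.
  by rewrite -(doubleK K) half_leq.
- exists N => n Nn; rewrite -(doubleK n); apply: bnd.
  by rewrite (leq_trans Nn)// -addnn leq_addr.
- move=> K; have [n Kn <-] := inf K; exists n.*2; last by rewrite doubleK.
  by rewrite (leq_trans Kn)// -addnn leq_addr.
- by exists N.*2 => n Nn; apply: bnd; rewrite -(doubleK N) half_leq.
Qed.

Lemma bprob_prob (R : realType) (M : mbp R) (s0 : mbp_S M) T w n s :
  last s0 w = s -> mbp_kind_of s = KProb -> bprob s0 T w n.+1 =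
  (\sum_(c | T (rcons w c)) mbp_p s c * bprob s0 T (rcons w c) n)%R.
Proof. by move=> <- /= ->. Qed.

Lemma bprob_branch (R : realType) (M : mbp R) (s0 : mbp_S M) T w n s :
  last s0 w = s -> mbp_kind_of s <> KProb -> bprob s0 T w n.+1 =
  (\prod_(c | mbp_E s c) bprob s0 T (rcons w c) n)%R.
Proof. by move=> <- /=; case: mbp_kind_of. Qed.

Section BranchingPlayOfTree.
Variables (R : realType) (Sigma Q : finType) (A : game_automaton Sigma Q).
Hypothesis Hdist : forall q a, trans_distinct (ga_delta A q a).
Local Notation M := (mbp_of_ga R A).
Local Notation S := (mbp_S M).
Local Notation s0 := (s_state R A (ga_q0 A)).
Implicit Types (t u : vertex -> Sigma) (x y : vertex).

(* The branching play of [t] has a vertex [node t x] labelled by a state of [A],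
   and its child [mid t x] labelled by a state-letter pair, for each [x]. *)
Definition node t x : seq S :=
  s0 :: flatten [seq [:: inr (ga_state A t (take i x), t (take i x));
                         inl (ga_state A t (take i.+1 x))]
                | i <- iota 0 (size x)].

Definition mid t x : seq S := rcons (node t x) (inr (ga_state A t x, t x)).

Arguments node : simpl never.
Arguments mid : simpl never.

Lemma node_rcons t x d :
  node t (rcons x d) = rcons (mid t x) (inl (ga_state A t (rcons x d))).
Proof.
have rcons2 (s : seq S) a b : rcons (rcons s a) b = s ++ [:: a; b].
  by rewrite -!cats1 -catA.
rewrite /mid rcons2 /node size_rcons -addn1 iotaD map_cat flatten_cat add0n /=.
have -> : take (size x) (rcons x d) = x by rewrite -cats1 take_size_cat.
rewrite [take _.+1 _]take_oversize ?size_rcons//.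
congr (_ :: flatten _ ++ _); apply/eq_in_map => i.
rewrite mem_iota add0n => /andP[_ ix].
by rewrite -cats1 !takel_cat// ltnW.
Qed.

Lemma mid_eq t u x y : mid t x = mid u y -> node t x = node u y /\ t x = u y.
Proof. by move=> e; have [-> []] := rcons_eq e. Qed.

Lemma size_node t x : size (node t x) = (size x).*2.+1.
Proof.
elim/last_ind: x => // x d IH.
by rewrite node_rcons !size_rcons IH doubleS.
Qed.

Lemma size_mid t x : size (mid t x) = (size x).*2.+2.
Proof. by rewrite size_rcons size_node. Qed.

Lemma last_node t x : last s0 (node t x) = inl (ga_state A t x).
Proof. by elim/last_ind: x => // x d IH; rewrite node_rcons last_rcons. Qed.

Lemma last_mid t x : last s0 (mid t x) = inr (ga_state A t x, t x).
Proof. by rewrite last_rcons. Qed.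

(** Here [qL <> qR] enters: the next state reveals the direction, so label sequences identify tree
    vertices. *)
Lemma trans_next_inj q a : injective (trans_next (ga_delta A q a)).
Proof.
by have := Hdist q a; case: ga_delta => qL qR /= ne [] [] // e; case: ne.
Qed.

Lemma node_inj t : injective (node t).
Proof.
elim/last_ind => [|x d IH] y.
  move=> /(congr1 size); rewrite !size_node => -[].
  by move/eqP; rewrite eq_sym double_eq0 size_eq0 => /eqP.
case/lastP: y => [|y e].
  by move=> /(congr1 size); rewrite !size_node size_rcons doubleS.
rewrite !node_rcons => eq; have [/mid_eq[/IH <- _] []] := rcons_eq eq.
by rewrite !ga_state_rcons => /trans_next_inj ->.
Qed.

Lemma mid_inj t : injective (mid t).
Proof. by move=> x y /mid_eq[/node_inj]. Qed.

Lemma node_neq_mid t u x y : node t x <> mid u y.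
Proof.
move=> e; have : odd (size (node t x)) = odd (size (mid u y)) by rewrite e.
by rewrite size_node size_mid /= !odd_double.
Qed.

Definition bplay_of t (w : seq S) : bool :=
  `[< exists x, w = node t x \/ w = mid t x >].

Lemma bplay_ofP t w : reflect (exists x, w = node t x \/ w = mid t x) (bplay_of t w).
Proof. exact: asboolP. Qed.

Lemma bplay_of_node t x : bplay_of t (node t x).
Proof. by apply/bplay_ofP; exists x; left. Qed.

Lemma bplay_of_mid t x : bplay_of t (mid t x).
Proof. by apply/bplay_ofP; exists x; right. Qed.

Lemma node_child t x c :
  bplay_of t (rcons (node t x) c) = (c == inr (ga_state A t x, t x)).
Proof.
apply/bplay_ofP/eqP => [[y [e|e]]|->]; last by exists x; right.
  have : odd (size (rcons (node t x) c)) = odd (size (node t y)) by rewrite e.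
  by rewrite size_rcons !size_node /= !odd_double.
by have [/node_inj-> ->] := rcons_eq e.
Qed.


Lemma mid_child t x c : bplay_of t (rcons (mid t x) c) =
  ga_mbp_E A (inr (ga_state A t x, t x)) c.
Proof.
apply/bplay_ofP/idP => [[y [|]]|].
- case/lastP: y => [/(congr1 size)|y d]; first by rewrite size_rcons size_mid.
  rewrite node_rcons => e; have [/mid_inj <- ->] := rcons_eq e; move=> {e} /=.
  by rewrite ga_state_rcons; case: d; rewrite eqxx ?orbT.
- move=> e.
  have : odd (size (rcons (mid t x) c)) = odd (size (mid t y)) by rewrite e.
  by rewrite size_rcons !size_mid /= !odd_double.
case: c => [q|//] /= /orP[]/eqP ->.
- by exists (rcons x DL); left; rewrite node_rcons ga_state_rcons.
- by exists (rcons x DR); left; rewrite node_rcons ga_state_rcons.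
Qed.

Lemma is_bplay_of t : is_bplay s0 (bplay_of t).
Proof.
split.
- exact: (bplay_of_node t [::]).
- move=> w /bplay_ofP[x [->|->]].
    case/lastP: x => [|x d]; [by left|right].
    exists (mid t x), (inl (ga_state A t (rcons x d))).
    rewrite node_rcons bplay_of_mid last_mid; split=> //=.
    by rewrite ga_state_rcons; case: d; rewrite eqxx ?orbT.
  right; exists (node t x), (inr (ga_state A t x, t x)).
  by rewrite bplay_of_node last_node; split=> //=.
- move=> w /bplay_ofP[x [->|->]]; last by rewrite last_mid /=; case: ifP.
  move=> _; exists (inr (ga_state A t x, t x)); rewrite node_child eqxx.
  by split=> // c; rewrite node_child => /eqP.
- move=> w /bplay_ofP[x [->|->]]; first by rewrite last_node.
  by move=> _ c; rewrite mid_child last_mid.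
Qed.

Lemma eq_node t u k : (forall x, (size x < k)%N -> t x = u x) ->
  forall x, (size x <= k)%N -> node t x = node u x.
Proof.
move=> tu; elim/last_ind => [//|x d IH] xk.
have xk' : (size x < k)%N by rewrite size_rcons in xk.
by rewrite !node_rcons /mid IH ?(ltnW xk')// !(eq_ga_state A tu)// ?(ltnW xk')// tu.
Qed.

(** The letter at [x] is shown by [mid t x], of size [(size x).*2.+2]; sizes up to [k.*2.+1] thus
    show exactly the letters at depth less than [k]. *)
Lemma bplay_of_agree t u k :
  (forall w, (size w <= k.*2.+1)%N -> bplay_of t w = bplay_of u w) <->
  (forall x, (size x < k)%N -> t x = u x).
Proof.
split=> [tu|tu w wk].
  (* Nodes and letters are compared together: equal nodes at [x] force equal letters there, which
     give equal nodes at its children. *)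
  suff H x : (size x <= k)%N ->
      node t x = node u x /\ ((size x < k)%N -> t x = u x).
    by move=> x xk; have [_ ->] := H x (ltnW xk).
  have letter y : node t y = node u y -> (size y < k)%N -> t y = u y.
    move=> e yk; have := tu (mid t y).
    rewrite size_mid bplay_of_mid ltnS ltn_double => /(_ yk)/esym.
    move/bplay_ofP=> [z [/esym/node_neq_mid//|]].
    by move=> /mid_eq[]; rewrite e => /node_inj <-.
  elim/last_ind: x => [_|x d IH]; first by split=> //; exact: letter.
  rewrite size_rcons => xk; have [e /(_ xk) tux] := IH (ltnW xk).
  suff e' : node t (rcons x d) = node u (rcons x d).
    by split=> // xk'; apply: letter => //; rewrite size_rcons.
  have es : ga_state A t x = ga_state A u x.
    by have := congr1 (last s0) e; rewrite !last_node => -[].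
  by rewrite !node_rcons /mid !ga_state_rcons es tux e.
suff H t' u' : (forall x, (size x < k)%N -> t' x = u' x) ->
    bplay_of t' w -> bplay_of u' w.
  by apply/idP/idP; apply: H => // x xk; rewrite tu.
move=> {}tu /bplay_ofP[x [e|e]]; move: wk; rewrite e.
  rewrite size_node ltnS leq_double => xk.
  by rewrite (eq_node tu)//; exact: bplay_of_node.
rewrite size_mid ltnS ltn_double => xk.
rewrite /mid (eq_node tu) ?(ltnW xk)// (eq_ga_state A tu) ?(ltnW xk)// tu//.
exact: bplay_of_mid.
Qed.

(** Two levels of the play read one letter: one factor for it, then a product over two children, so
    the exponents satisfy [e (k+1) = 1 + 2 * e k]. *)
Lemma bprob_bplay_of t x k :
  bprob (M := M) s0 (bplay_of t) (node t x) k.*2 =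
  ((#|Sigma|%:R^-1) ^+ (2 ^ k).-1)%R.
Proof.
elim: k x => [|k IH] x; first by rewrite expr0.
rewrite doubleS (bprob_prob _ _ (last_node t x)) //.
rewrite (big_pred1 (inr (ga_state A t x, t x))); last first.
  by move=> c; rewrite node_child.
rewrite -/(mid t x) (bprob_branch _ _ (last_mid t x)); last first.
  by rewrite /=; case: ifP.
set q := ga_state A t x; set a := t x.
have child d : bprob (M := M) s0 (bplay_of t)
    (rcons (mid t x) (inl (trans_next (ga_delta A q a) d))) k.*2 =
    ((#|Sigma|%:R^-1) ^+ (2 ^ k).-1)%R.
  by rewrite -ga_state_rcons -node_rcons IH.
have -> : (2 ^ k.+1).-1 = (1 + ((2 ^ k).-1 + (2 ^ k).-1))%N.
  have := expn_gt0 2 k; rewrite expnS; case: (2 ^ k)%N => // m _.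
  by rewrite mul2n -addnn addnS addSn add1n.
rewrite exprD expr1 exprD /= eqxx; congr (_ * _)%R.
(* Distinct successors give the product two factors instead of one. *)
have LR : trans_next (ga_delta A q a) DR != trans_next (ga_delta A q a) DL.
  by apply/eqP => /trans_next_inj.
rewrite (bigD1 (inl (trans_next (ga_delta A q a) DL))) /= ?eqxx// child.
congr (_ * _)%R; rewrite -[RHS](child DR); apply: big_pred1 => -[q'|[]] //=.
rewrite !(inj_eq inl_inj) /=; have [->|] := eqVneq q' (trans_next _ DR).
  by rewrite LR orbT.
by rewrite orbF andbN.
Qed.

(** * Strategies on a tree and on its branching play *)

Lemma node_prefix t x y (u : nat -> S) : node t x = mkseq u (size x).*2.+1 ->
  node t y = mkseq u (size x).*2.+3 ->
  [/\ u (size x).*2.+1 = inr (ga_state A t x, t x),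
     u (size x).*2.+2 = inl (ga_state A t y) & exists d, y = rcons x d].
Proof.
case/lastP: y => [|y d] ex.
  by move/(congr1 size); rewrite size_node size_mkseq.
rewrite node_rcons mkseqS => e; have {e} [e <-] := rcons_eq e.
move: e; rewrite mkseqS -ex => e; have [/node_inj yx] := rcons_eq e.
by rewrite yx => ->; split=> //; exists d.
Qed.

Lemma ga_accepts_bplay_win t : ga_accepts A t -> bplay_win s0 (bplay_of t).
Proof.
move=> [sigma sP].
(* By [mid_inj] the vertex [w] determines [x], so the choice of child is well defined; [s0] is a
   junk value elsewhere. *)
have /choice[tau tauP] (w : seq S) : exists s : S, forall x, w = mid t x ->
    s = inl (ga_state A t (rcons x (sigma x))).
  have [[x ->]|nw] := pselect (exists x, w = mid t x).
    by exists (inl (ga_state A t (rcons x (sigma x)))) => y /mid_inj <-.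
  by exists s0 => x wx; exfalso; apply: nw; exists x.
exists tau; split=> [w /bplay_ofP[x [->|->]]|u u0 uT ucons].
- by rewrite last_node.
- by move=> _; rewrite (tauP _ x erefl) -node_rcons bplay_of_node.
(* Prefixes of odd size are nodes; their tree vertices form the branch followed by [u]. *)
have /choice[y yP] n : exists x, node t x = mkseq u n.*2.+1.
  have /bplay_ofP[x [|e]] := uT n.*2; first by exists x.
  have : odd (size (mkseq u n.*2.+1)) = odd (size (mid t x)) by rewrite e.
  by rewrite size_mkseq size_mid /= !odd_double.
have size_y n : size (y n) = n.
  have /(congr1 size) := yP n; rewrite size_node size_mkseq => -[].
  exact: double_inj.
have yS n : [/\ u n.*2.+1 = inr (ga_state A t (y n), t (y n)),
     u n.*2.+2 = inl (ga_state A t (y n.+1)) & exists d, y n.+1 = rcons (y n) d].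
  by have := @node_prefix t (y n) (y n.+1) u; rewrite size_y; apply; exact: yP.
have /choice[d dP] n : exists d, y n.+1 = rcons (y n) d by have [] := yS n.
have path_d n : path_vertex d n = y n.
  elim: n => [|n IH]; first by apply/esym/eqP; rewrite -size_eq0 size_y.
  by rewrite /path_vertex mkseqS -/(path_vertex d n) IH dP.
suff -> : (fun n => mbp_Par (u n)) =
    (fun n => ga_pri A (ga_state A t (path_vertex d n./2))).
  apply/(parity_win_half (fun n => ga_pri A (ga_state A t (path_vertex d n)))).
  apply: sP => n /=; rewrite path_d => yo.
  have [u1 u2 _] := yS n.
  have mid_y : mkseq u n.*2.+2 = mid t (y n) by rewrite mkseqS -yP u1.
  have := ucons n.*2.+1; rewrite u1 /= yo mid_y => /(_ erefl).
  rewrite u2 (tauP _ _ erefl) dP => -[].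
  by rewrite !ga_state_rcons => /trans_next_inj.
apply/funext => n; rewrite path_d -[in LHS](odd_double_half n).
case: (odd n) => /=; first by rewrite add1n; have [-> _ _] := yS n./2.
rewrite add0n; case: n./2 => [|m]; last by rewrite doubleS; have [_ -> _] := yS m.
by rewrite u0 (size0nil (size_y 0%N)).
Qed.

Lemma bplay_win_ga_accepts t : bplay_win s0 (bplay_of t) -> ga_accepts A t.
Proof.
move=> [tau [tauT tauP]].
have /choice[sigma sigmaP] x : exists d,
    trans_is_or (ga_delta A (ga_state A t x) (t x)) ->
    tau (mid t x) = inl (ga_state A t (rcons x d)).
  have [xo|] := boolP (trans_is_or _); last by exists DL.
  have := tauT _ (bplay_of_mid t x); rewrite last_mid /= xo => /(_ erefl).
  rewrite mid_child; case: (tau _) => //= q /orP[]/eqP ->;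
    [exists DL|exists DR] => _; by rewrite ga_state_rcons.
exists sigma => d cons.
(* The labels along the branch [d]: states at even indices, state-letter pairs at odd ones. *)
pose u n : S := let x := path_vertex d n./2 in
  if odd n then inr (ga_state A t x, t x) else inl (ga_state A t x).
have u_even n : u n.*2 = inl (ga_state A t (path_vertex d n)).
  by rewrite /u odd_double doubleK.
have u_odd n : u n.*2.+1 = inr (ga_state A t (path_vertex d n), t (path_vertex d n)).
  by rewrite /u /= odd_double uphalf_double.
have path_dS n : path_vertex d n.+1 = rcons (path_vertex d n) (d n) by exact: mkseqS.
have mkseq_mid n : mkseq u n.*2.+1 = node t (path_vertex d n) ->
    mkseq u n.*2.+2 = mid t (path_vertex d n).
  by move=> e; rewrite mkseqS e u_odd.
have mkseq_node n : mkseq u n.*2.+1 = node t (path_vertex d n).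
  elim: n => [//|n IH]; rewrite doubleS mkseqS (mkseq_mid _ IH).
  by rewrite path_dS node_rcons -path_dS -doubleS u_even.
have : parity_win (fun n => mbp_Par (u n)).
  apply: tauP => // n.
    rewrite -(odd_double_half n); case: (odd n) => /=.
      by rewrite add1n mkseq_mid// bplay_of_mid.
    by rewrite add0n mkseq_node bplay_of_node.
  rewrite -(odd_double_half n); case: (odd n); last by rewrite add0n u_even.
  rewrite add1n u_odd /= mkseq_mid//; case: ifP => // no _.
  by rewrite -doubleS u_even sigmaP// path_dS -cons.
rewrite [X in parity_win X](_ : _ =
    (fun n => ga_pri A (ga_state A t (path_vertex d n./2)))).
  by move/(parity_win_half (fun n => ga_pri A (ga_state A t (path_vertex d n)))).
by apply/funext => n; rewrite /u; case: (odd n).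
Qed.

End BranchingPlayOfTree.

(** * Finite depth cylinders *)

Fixpoint words_lt k : seq vertex :=
  if k is k'.+1 then
    [::] :: map (cons DL) (words_lt k') ++ map (cons DR) (words_lt k')
  else [::].

Lemma mem_words_lt k x : (x \in words_lt k) = (size x < k)%N.
Proof.
elim: k x => [//|k IH] [|i x] //=; rewrite ltnS -IH inE /= mem_cat.
have cons_inj j : injective (cons j : vertex -> vertex) by move=> y z [].
have other j j' : j != j' -> (cons j x \in map (cons j') (words_lt k)) = false.
  by move=> /eqP jj'; apply/negP => /mapP[y _ []].
case: i; rewrite mem_map ?other ?orbF//; exact: cons_inj.
Qed.

Lemma size_words_lt k : size (words_lt k) = (2 ^ k).-1.
Proof.
elim: k => //= k IH; rewrite size_cat !size_map IH expnS.
have := expn_gt0 2 k; case: (2 ^ k)%N => // m _.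
by rewrite mul2n -addnn addnS addSn.
Qed.

Lemma uniq_words_lt k : uniq (words_lt k).
Proof.
elim: k => //= k IH; rewrite mem_cat cat_uniq !map_inj_uniq ?IH; last 2 first.
- by move=> y z [].
- by move=> y z [].
rewrite /= andbT; apply/andP; split.
  by apply/negP => /orP[] /mapP[].
by apply/hasPn => _ /mapP[x _ ->]; apply/negP => /mapP[].
Qed.

Lemma measurable_forall d (T : measurableType d) (V : countType)
    (F : V -> set T) : (forall v, measurable (F v)) ->
  measurable [set t | forall v, F v t].
Proof.
move=> mF; rewrite [X in measurable X](_ : _ =
    \bigcap_n (if unpickle n is Some v then F v else setT)).
  by apply: bigcapT_measurable => n; case: unpickle.
apply/seteqP; split=> t /=; first by move=> Ft n _; case: unpickle => //=.
by move=> Ft v; have := Ft (pickle v) I; rewrite pickleK.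
Qed.

Section Cylinders.
Variables (Sigma : finType) (a0 : Sigma).
Implicit Types (t u : vertex -> Sigma).

(** Below the prefix the index is out of range and the letter is [a0]: one representative tree for
    each of finitely many prefixes. *)
Definition tree_of_prefix k (f : (size (words_lt k)).-tuple Sigma) : vertex -> Sigma :=
  fun x => nth a0 f (index x (words_lt k)).

Lemma tree_prefix k t : exists f : (size (words_lt k)).-tuple Sigma,
  forall x, (size x < k)%N -> t x = tree_of_prefix f x.
Proof.
exists (map_tuple t (in_tuple (words_lt k))) => x xk.
rewrite /tree_of_prefix /= (nth_map [::]) ?nth_index// ?index_mem mem_words_lt//.
Qed.

Lemma tree_of_prefix_inj k (f g : (size (words_lt k)).-tuple Sigma) :
  (forall x, (size x < k)%N -> tree_of_prefix f x = tree_of_prefix g x) -> f = g.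
Proof.
move=> fg; apply/val_inj/(@eq_from_nth _ a0) => [|i]; first by rewrite !size_tuple.
rewrite size_tuple => ik; have := fg (nth [::] (words_lt k) i).
rewrite -mem_words_lt mem_nth// => /(_ isT).
by rewrite /tree_of_prefix index_uniq// uniq_words_lt.
Qed.

Definition cylinder k t : set (coin_space a0) :=
  [set u | forall x, (size x < k)%N -> u x = t x].

Lemma measurable_cylinder k t : measurable (cylinder k t).
Proof.
apply: measurable_forall => x.
case: (ltnP (size x) k) => xk; last first.
  by rewrite [X in measurable X](_ : _ = setT); [exact: measurableT|apply/seteqP].
rewrite [X in measurable X](_ : _ = [set u : coin_space a0 | u x = t x]).
  exact: measurable_letter.
by apply/seteqP; split=> u /=; [apply|].
Qed.

Lemma letter_cylinders v a : [set t : coin_space a0 | t v = a] =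
  \bigcup_(f in [set f : (size (words_lt (size v).+1)).-tuple Sigma
                | tree_of_prefix f v = a])
    cylinder (size v).+1 (tree_of_prefix f).
Proof.
apply/seteqP; split=> t /=.
  have [f tf] := tree_prefix (size v).+1 t; move=> tva.
  by exists f => //=; rewrite -tf.
by move=> [f /= <-]; apply.
Qed.

Lemma sigma_cylinders :
  @measurable _ (coin_space a0) = <<s [set C | exists k t, C = cylinder k t] `|` [set set0] >>.
Proof.
apply/seteqP; split.
  apply: smallest_sub; first exact: smallest_sigma_algebra.
  move=> _ [v [a ->]]; rewrite letter_cylinders.
  apply: (@fin_bigcup_measurable _ (g_sigma_algebraType _)); first exact: finite_finset.
  by move=> f _; apply: sub_sigma_algebra; left; exists (size v).+1, (tree_of_prefix f).
apply: smallest_sub; first exact: sigma_algebra_measurable.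
by move=> _ [[k [t ->]]|->]; [exact: measurable_cylinder|exact: measurable0].
Qed.

(** Of two cylinders the deeper lies in the other or is disjoint from it; adding [set0] makes a
    pi-system. *)
Lemma setI_closed_cylinders :
  setI_closed ([set C | exists k t, C = cylinder k t] `|` [set set0]).
Proof.
move=> C C' [|->]; last by move=> _; right; rewrite set0I.
move=> [k [t ->]] [|->]; last by right; rewrite setI0.
move=> [l [u ->]].
wlog kl : k l t u / (k <= l)%N.
  move=> h; have [kl|/ltnW lk] := leqP k l; first exact: h.
  by rewrite setIC; exact: h.
have [tu|ntu] := pselect (cylinder k t u).
  left; exists l, u; apply: setIidr => s su x xk.
  by rewrite su ?tu// (leq_trans xk).
right; apply/seteqP; split=> // s [st su]; apply: ntu => x xk.
by rewrite -st// su// (leq_trans xk).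
Qed.

Lemma coin_flipping_cylinder (R : realType) (mu : probability (coin_space a0) R) k t :
  is_coin_flipping mu ->
  mu (cylinder k t) = ((#|Sigma|%:R^-1) ^+ (2 ^ k).-1)%:E%R.
Proof.
move=> Hmu; have := Hmu [seq (x, t x) | x <- words_lt k].
rewrite -map_comp size_map size_words_lt => <-; last first.
  by rewrite map_inj_uniq ?uniq_words_lt// => x y.
congr (mu _); apply/seteqP; split=> u h.
  by move=> _ /mapP[x xk ->] /=; apply: h; rewrite -mem_words_lt.
move=> x; rewrite -mem_words_lt => xk.
exact: (h (x, t x) (map_f _ xk)).
Qed.

Lemma probability_eq_cylinder (R : realType)
    (m1 m2 : {measure set (coin_space a0) -> \bar R}%R) : (m1 setT < +oo)%E ->
  (forall k t, m1 (cylinder k t) = m2 (cylinder k t)) ->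
  forall B, measurable B -> m1 B = m2 B.
Proof.
move=> fin m12.
have cyl0 : cylinder 0 (fun=> a0) = setT by apply/seteqP.
apply: (measure_unique _ (fun=> setT) sigma_cylinders setI_closed_cylinders).
- by move=> _; left; exists 0%N, (fun=> a0).
- exact: bigcup_const.
- by move=> _ [[k [t ->]]|->]; rewrite ?measure0.
- by [].
Qed.

End Cylinders.

(** * Transfer along the bijection between trees and branching plays *)

Section Transfer.
Variables (R : realType) (Sigma Q : finType) (a0 : Sigma) (A : game_automaton Sigma Q).
Hypothesis Hdist : forall q a, trans_distinct (ga_delta A q a).
Local Notation M := (mbp_of_ga R A).
Local Notation s0 := (s_state R A (ga_q0 A)).
Local Notation play t := (bplay_of t : bplay_space M).
Implicit Types (t u : vertex -> Sigma).

Definition play_prefix k t : set (bplay_space M) :=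
  [set T | forall w, (size w <= k.*2.+1)%N -> T w = bplay_of t w].

Lemma measurable_play_prefix k t : measurable (play_prefix k t).
Proof.
apply: measurable_forall => w; case: (leqP (size w) k.*2.+1) => wk; last first.
  by rewrite [X in measurable X](_ : _ = setT); [exact: measurableT|apply/seteqP].
rewrite [X in measurable X](_ : _ = [set T : bplay_space M | T w = bplay_of t w]).
  by apply: sub_sigma_algebra; exists w, (bplay_of t w).
by apply/seteqP; split=> T /=; [apply|].
Qed.

Lemma play_prefixP k t u : play_prefix k t (play u) <-> cylinder (a0 := a0) k t u.
Proof. exact: bplay_of_agree. Qed.

Lemma play_prefix_meet k t u T : play_prefix k t T -> play_prefix k u T ->
  cylinder (a0 := a0) k t u.
Proof. by move=> Tt Tu; apply/play_prefixP => w wk; rewrite -Tu// Tt. Qed.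

Lemma bplay_of_inj : injective (fun t => play t).
Proof.
move=> t u tu; apply/funext => x.
have : play_prefix (size x).+1 u (play t) by move=> w _; rewrite tu.
by move/play_prefixP; apply.
Qed.

Definition is_play : set (bplay_space M) := [set T | exists t, T = play t].

Definition known_prefix k : set (bplay_space M) :=
  \bigcup_(f : (size (words_lt k)).-tuple Sigma) play_prefix k (tree_of_prefix a0 f).

Lemma measurable_known_prefix k : measurable (known_prefix k).
Proof.
by apply: fin_bigcup_measurable => [|f _];
  [exact: finite_finset|exact: measurable_play_prefix].
Qed.

Lemma is_playE : is_play = \bigcap_k known_prefix k.
Proof.
apply/seteqP; split=> T.
  move=> [t ->] k _; have [f tf] := tree_prefix a0 k t.
  by exists f => //; apply/play_prefixP.
move=> TP; have /choice[t tP] k : exists t, play_prefix k t T.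
  by have [f _ Tf] := TP k I; exists (tree_of_prefix a0 f).
(* The trees [t k] agree on the depths they share, so reading [x] at a depth just sufficient to show
   it glues them into one tree. *)
pose u x := t (size x).+1 x.
have ut k : cylinder (a0 := a0) k (t k) u.
  move=> x xk; have /(_ T) h := @play_prefix_meet (size x).+1 (t k) (t (size x).+1).
  apply: h => // w wx; rewrite (tP k)//; apply: leq_trans wx _.
  by rewrite ltnS leq_double.
exists u; apply/funext => w.
have wk : (size w <= (size w).*2.+1)%N by rewrite leqW// -addnn leq_addr.
by rewrite (tP (size w))// -(iffRL (play_prefixP _ _ _) (ut (size w))).
Qed.

Lemma measurable_is_play : measurable is_play.
Proof. by rewrite is_playE; apply: bigcapT_measurable => k; exact: measurable_known_prefix. Qed.

(** The inverse of [bplay_of], with the constant tree [a0] as default on a set shown negligible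
    below. *)
Definition decode (T : bplay_space M) : coin_space a0 :=
  if pselect (exists t, T = play t) is left h then projT1 (cid h) else fun=> a0.

Lemma decodeK t : decode (play t) = t.
Proof.
rewrite /decode; case: pselect => [h|[]]; last by exists t.
by case: cid => u /= /bplay_of_inj.
Qed.

Lemma measurable_decode : measurable_fun setT decode.
Proof.
apply: (@measurability _ _ (bplay_space M) (coin_space a0) setT decode (coin_gen (a0:=a0))) => //.
move=> _ [_ [v [a ->]] <-]; rewrite setTI.
(* The default puts all non-plays into the preimage exactly when [a0 = a]. *)
rewrite [X in measurable X](_ : _ = is_play `&`
    (\bigcup_(f in [set f : (size (words_lt (size v).+1)).-tuple Sigma
                   | tree_of_prefix a0 f v = a])
       play_prefix (size v).+1 (tree_of_prefix a0 f)) `|`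
    (if a0 == a then ~` is_play else set0)).
  apply: measurableU; last first.
    by case: ifP => _; [by apply: measurableC; exact: measurable_is_play|exact: measurable0].
  apply: measurableI; first exact: measurable_is_play.
  apply: fin_bigcup_measurable => [|f _];
    [exact: finite_finset|exact: measurable_play_prefix].
apply/seteqP; split=> T /=.
  have [[t ->]|nT] := pselect (is_play T).
    rewrite decodeK => tva; left; split; first by exists t.
    have [f tf] := tree_prefix a0 (size v).+1 t.
    by exists f; [rewrite /= -tf|apply/play_prefixP].
  by rewrite /decode; case: pselect => // _ <-; right; rewrite eqxx.
move=> [[[t ->] [f /= fv /play_prefixP tf]]|]; first by rewrite decodeK tf.
by case: eqP => // <- nT; rewrite /decode; case: pselect.
Qed.

HB.instance Definition _ := isMeasurableFun.Build _ _ _ _ decode measurable_decode.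

Variables (mu : probability (coin_space a0) R) (muM : probability (bplay_space M) R).
Hypotheses (Hmu : is_coin_flipping mu) (HmuM : is_mbp_measure s0 muM).

Lemma measure_play_prefix k t : muM (play_prefix k t) = mu (cylinder (a0 := a0) k t).
Proof.
rewrite (coin_flipping_cylinder _ _ Hmu) -(bprob_bplay_of R Hdist t [::]).
exact: (HmuM (is_bplay_of R Hdist t)).
Qed.

(** The cylinders over the same finite index set partition the tree space, and each has the measure
    of the matching play prefix. *)
Lemma measure_known_prefix k : muM (known_prefix k) = 1%E.
Proof.
rewrite -(probability_setT mu).
have -> : [set: coin_space a0] =
    \bigcup_(f : (size (words_lt k)).-tuple Sigma) cylinder (a0 := a0) k (tree_of_prefix a0 f).
  apply/esym/seteqP; split=> // t _.
  by have [f tf] := tree_prefix a0 k t; exists f.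
have fin : finite_set [set: (size (words_lt k)).-tuple Sigma] by exact: finite_finset.
rewrite (measure_fin_bigcup _ fin); last 2 first.
- move=> f g _ _ [T [/play_prefix_meet Tf /Tf fg]].
  by apply/esym/(tree_of_prefix_inj (a0 := a0)).
- by move=> f _; exact: measurable_play_prefix.
rewrite (measure_fin_bigcup _ fin); last 2 first.
- move=> f g _ _ [t [tf tg]]; apply: (tree_of_prefix_inj (a0 := a0)) => x xk.
  by rewrite -tf// tg.
- by move=> f _; exact: measurable_cylinder.
by apply: eq_fsbigr => f _; exact: measure_play_prefix.
Qed.

Lemma negligible_not_play : muM.-negligible (~` is_play).
Proof.
rewrite is_playE setC_bigcap; apply: negligible_bigcup => k.
apply/negligibleP; first by apply: measurableC; exact: measurable_known_prefix.
have := probability_setC muM (measurable_known_prefix k).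
by rewrite measure_known_prefix subee.
Qed.

Lemma measure_setI_play X : measurable X -> muM (X `&` is_play) = muM X.
Proof.
move=> mX; rewrite -[in RHS](setUIDK X is_play).
have mp := measurable_is_play.
rewrite measureU0//; [exact: measurableI|exact: measurableD|].
apply: measure_negligible; first exact: measurableD.
by apply: negligibleS negligible_not_play => T [].
Qed.

(** The law of [decode] agrees with [mu] on cylinders, whose preimages are play prefixes up to
    non-plays. *)
Lemma measure_decode B : measurable B -> muM (decode @^-1` B) = mu B.
Proof.
have mdec C : measurable C -> measurable (decode @^-1` C).
  by move=> mC; rewrite -[X in measurable X]setTI; exact: measurable_decode.
move=> mB; apply/esym.
have fin : (mu setT < +oo)%E by rewrite probability_setT ltry.
apply: (probability_eq_cylinder (m1 := mu) (m2 := distribution muM decode) fin) => // k t.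
transitivity (muM (play_prefix k t)); first by rewrite measure_play_prefix.
transitivity (muM (decode @^-1` cylinder (a0 := a0) k t)); last by [].
rewrite -[LHS]measure_setI_play; last exact: measurable_play_prefix.
rewrite -[RHS]measure_setI_play; last by apply: mdec; exact: measurable_cylinder.
congr (muM _); apply/seteqP; split=> T [+ [u uT]]; rewrite uT => Tu.
- split; last by exists u.
  by rewrite /preimage /= decodeK; apply/play_prefixP.
- by split; [move: Tu; rewrite /preimage /= decodeK => /play_prefixP|exists u].
Qed.

Lemma completed_value_transfer v : completed_value mu (ga_language a0 A) v ->
  completed_value muM (bplay_winset s0) v.
Proof.
move=> [B [C [mB mC BL LC [<- CB]]]].
have mdec D : measurable D -> measurable (decode @^-1` D).
  by move=> mD; rewrite -[X in measurable X]setTI; exact: measurable_decode.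
have mp := measurable_is_play.
(* The winner on non-plays is unknown; being negligible, they are left out of the inner bound and
   put into the outer one. *)
exists (decode @^-1` B `&` is_play), (decode @^-1` C `|` ~` is_play); split.
- by apply: measurableI => //; exact: mdec.
- by apply: measurableU; [exact: mdec|exact: measurableC].
- move=> T [+ [t Tt]]; rewrite /preimage /= Tt decodeK => /BL.
  exact: ga_accepts_bplay_win.
- move=> T winT; have [[t Tt]|nT] := pselect (is_play T); last by right.
  left; rewrite Tt /preimage /= decodeK; apply: LC.
  by apply: (bplay_win_ga_accepts (R := R) Hdist); rewrite -Tt.
- split; first by rewrite measure_setI_play ?measure_decode//; exact: mdec.
  rewrite measureU0; [exact: etrans (measure_decode mC) CB|exact: mdec|exact: measurableC|].
  by apply: measure_negligible; [exact: measurableC|exact: negligible_not_play].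
Qed.

End Transfer.

Theorem theorem4 (R : realType) (Sigma Q : finType) (a0 : Sigma)
    (A : game_automaton Sigma Q)
    (Hdist : forall (q : Q) (a : Sigma), trans_distinct (ga_delta A q a))
    (mu : probability (coin_space a0) R) (Hmu : is_coin_flipping mu)
    (muM : probability (bplay_space (mbp_of_ga R A)) R)
    (HmuM : is_mbp_measure (s_state R A (ga_q0 A)) muM) :
  exists v : \bar R,
    completed_value mu (ga_language a0 A) v /\
    completed_value muM (bplay_winset (s_state R A (ga_q0 A))) v.
Proof.
have [v Lv] := completely_measurable_value (completely_measurable_language A mu).
by exists v; split=> //; exact: (completed_value_transfer Hdist Hmu HmuM).
Qed.
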